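(* Let $b$ and $n$ be positive integers and let $C_b(n) := nb^n+1$. If $n^{b^n}\equiv (-1)^b \pmod{C_b(n)}$, then $C_b(n)$ is a Fermat (weak) probable prime to base $b$, i.e. $$b^{C_b(n)-1}\equiv 1 \pmod{C_b(n)}.$$
   Context: The integers $C_b(n) = nb^n+1$ are called Generalized Cullen Numbers. An integer $N>1$ is a Fermat (or weak) probable prime to base $a$ if $a^{N-1}\equiv 1 \pmod N$. *)

(* Defs.v *)
From mathcomp Require Import all_boot all_order all_algebra.

Set Implicit Arguments.
Unset Strict Implicit.
Unset Printing Implicit Defensive.

Import GRing.Theory.

Definition gen_cullen (b n : nat) : nat := (n * b ^ n + 1)%N.

Definition fermat_probable_prime (N : nat) (a : int) : Prop :=
  (1 < N)%N /\ ((a ^+ (N - 1) = 1 %[mod N%:Z])%Z)%R.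

(* Main.v *)
Require Import Defs.
From mathcomp Require Import all_boot all_order all_algebra.

(** Write [N = n b^n + 1], so that [n b^n = -1] modulo [N].  Raising this to
    the power [b^n] gives [n^(b^n) * b^(n b^n) = (-1)^(b^n)], in which the
    second factor is [b^(N-1)].  By hypothesis the first factor is [(-1)^b],
    and [(-1)^(b^n) = (-1)^b] because [b^n] and [b] have the same parity for
    [n > 0].  Cancelling the unit [(-1)^b] leaves [b^(N-1) = 1]. *)

Import GRing.Theory.
Local Open Scope ring_scope.

Lemma gen_cullen_subn1 (b n : nat) : (gen_cullen b n - 1 = n * b ^ n)%N.
Proof. by rewrite /gen_cullen addnK. Qed.

Lemma gen_cullen_modN1 (b n : nat) :
  ((n * b ^ n)%N%:Z = -1 %[mod (gen_cullen b n)%:Z])%Z.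
Proof. by apply/eqP; rewrite eqz_mod_dvd opprK -PoszD dvdzz. Qed.

Lemma signr_expn (R : pzRingType) (b n : nat) :
  (0 < n)%N -> (-1) ^+ (b ^ n)%N = (-1) ^+ b :> R.
Proof.
by move=> n_gt0; rewrite -signr_odd oddX eqn0Ngt n_gt0 /= signr_odd.
Qed.

Theorem proposition6 (b n : nat) (b_gt0 : (0 < b)%N) (n_gt0 : (0 < n)%N)
    (cong : (n%:Z ^+ (b ^ n)%N = (-1) ^+ b %[mod (gen_cullen b n)%:Z])%Z) :
  fermat_probable_prime (gen_cullen b n) b%:Z.
Proof.
split; first by rewrite /gen_cullen addn1 ltnS muln_gt0 n_gt0 expn_gt0 b_gt0.
rewrite gen_cullen_subn1.
have factorE : (n * b ^ n)%N%:Z ^+ (b ^ n)%N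
             = n%:Z ^+ (b ^ n)%N * b%:Z ^+ (n * b ^ n)%N :> int.
  by rewrite exprM -[b%:Z]natz -natrX natz PoszM exprMn.
have signM : ((-1) ^+ b * b%:Z ^+ (n * b ^ n)%N
              = (-1) ^+ b %[mod (gen_cullen b n)%:Z])%Z.
  rewrite -modzMml -cong modzMml -factorE.
  by rewrite -modzXm gen_cullen_modN1 modzXm signr_expn.
(* [(-1)^b] is its own inverse, so cancelling it means multiplying by it. *)
rewrite -[b%:Z ^+ _](signrMK b) -modzMmr signM modzMmr.
by rewrite -expr2 sqrr_sign.
Qed.
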